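(* For every integer $\ell\ge 1$ and every positive integer $n$, $$\phi_\ell(n)=|B_\ell(n)|.$$
   Context: For an integer $\ell\ge 1$ and a positive integer $n$, the Euler $\ell$-totient is $$\phi_\ell(n):=n\prod_{\substack{p\ \text{prime}\\ p^\ell\mid n}}\left(1-\frac1p\right)$$ (an empty product equals $1$), and $$B_\ell(n):=\{\,m\in\{1,2,\dots,n\} \mid \text{for every prime } p \text{ with } p^\ell\mid n,\ p\nmid m\,\}.$$ *)

(* Defs.v *)
From mathcomp Require Import all_boot all_order all_algebra.

Set Implicit Arguments.
Unset Strict Implicit.
Unset Printing Implicit Defensive.

Import GRing.Theory.

(* For 0 < l and 0 < n, every prime p with p ^ l %| n satisfies p <= n
   ([prime_pow_dvd_le]), so the bound p <= n used in the two definitions below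
   excludes no prime. *)
Lemma prime_pow_dvd_le (l n p : nat) :
  0 < l -> 0 < n -> p ^ l %| n -> p <= n.
Proof.
move=> l_gt0 n_gt0 pln.
apply: dvdn_leq => //; apply: dvdn_trans pln; exact: dvdn_exp.
Qed.

Definition euler_totient (l n : nat) : rat :=
  (n%:R * \prod_(1 <= p < n.+1 | prime p && (p ^ l %| n)%N) (1 - p%:R^-1))%R.

(* The elements of {1, ..., n} are the nonzero elements of 'I_n.+1. *)
Definition B (l n : nat) : {set 'I_n.+1} :=
  [set m : 'I_n.+1 |
    (0 < m) && [forall p : 'I_n.+1, prime p ==> (p ^ l %| n) ==> ~~ (p %| m)]].

Lemma in_B (l n : nat) (m : 'I_n.+1) : 0 < l -> 0 < n ->
  m \in B l n <->
  1 <= m <= n /\ (forall p : nat, prime p -> p ^ l %| n -> ~~ (p %| m)).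
Proof.
move=> l_gt0 n_gt0; rewrite inE -(ltnS m n) ltn_ord andbT; split.
- case/andP=> m_gt0 /forallP mB; split=> // p p_pr pln.
  have lt_p : p < n.+1 by rewrite ltnS (prime_pow_dvd_le l_gt0).
  by have /implyP/(_ p_pr)/implyP/(_ pln) := mB (Ordinal lt_p).
- case=> -> mB; apply/forallP=> p; apply/implyP=> p_pr; apply/implyP=> pln.
  exact: mB.
Qed.

(* Main.v *)
Require Import Defs.
From mathcomp Require Import all_boot all_order all_algebra.

(** Since [l >= 1], every prime [p] with [p ^ l %| n] divides [n], and distinct
    primes are coprime, so the statement is an instance of a sieve: if pairwise
    coprime moduli [q] in a list [s] all divide [N], the proportion of integers
    of [1, N] that avoid all multiples of the moduli is the product of the
    [1 - 1 / q] ([count_sieve]).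

    The sieve goes by induction on the list, with Legendre's recursion.  Among
    the integers of [1, p * k] that survive [s], those to be discarded when [p]
    is added are the [p * j] with [1 <= j <= k]; because [p] is coprime to the
    moduli of [s], [p * j] survives [s] exactly when [j] does, and the moduli of
    [s] still divide [k].  So the count for [p :: s] is the count for [s] up to
    [p * k] minus the count for [s] up to [k], which multiplies the proportion
    by [1 - 1 / p]. *)

Import GRing.Theory.

Section Sieve.

Local Open Scope ring_scope.

Lemma sum_multiples (V : nmodType) (p k : nat) (P : pred nat) (F : nat -> V) :
  (0 < p)%N ->
  \sum_(1 <= m < (p * k).+1 | (p %| m)%N && P m) F m =
  \sum_(1 <= j < k.+1 | P (p * j)%N) F (p * j)%N.
Proof.
move=> p_gt0; rewrite big_mkcond [RHS]big_mkcond /=.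
elim: k => [|k IHk]; first by rewrite muln0 !big_geq.
rewrite [RHS]big_nat_recr //= -IHk (big_cat_nat (n := (p * k).+1)) //=; last first.
  by rewrite ltnS leq_mul2l leqnSn orbT.
congr (_ + _); rewrite mulnS addnC big_nat_recr /=; last first.
  by rewrite -[X in (X < _)%N]addn0 ltn_add2l.
rewrite dvdn_addr ?dvdn_mulr // dvdnn /=.
(* The other integers of the block lie strictly between two multiples of p. *)
rewrite big_nat_cond big1 ?add0r // => m /andP[/andP[lt_pk_m lt_m_pk] _].
case: ifP => // /andP[/dvdnP[c def_m] _]; move: lt_pk_m lt_m_pk.
rewrite def_m (mulnC c) -mulnSr !ltn_pmul2l // ltnS => lt_kc le_ck.
by rewrite ltnNge le_ck in lt_kc.
Qed.

(** Pairwise coprime moduli suffice, prime or not: coprimality is what lets a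
    factor [p] be cancelled from [q %| p * j] and from [q %| p * k].  The
    divisibility hypothesis makes the count an exact proportion of [N], with no
    rounding term. *)
Lemma count_sieve (s : seq nat) (N : nat) :
  (0 < N)%N -> pairwise coprime s -> all (fun q => q %| N)%N s ->
  \sum_(1 <= m < N.+1 | all (fun q => ~~ (q %| m)%N) s) 1
    = N%:R * \prod_(q <- s) (1 - q%:R^-1) :> rat.
Proof.
elim: s N => [|p s IHs] N N_gt0 /=.
  by rewrite big_nil mulr1 sumr_const_nat subn1.
move=> /andP[/allP co_p_s co_s] /andP[/dvdnP[k def_N] s_dvd_N].
move: N_gt0; rewrite def_N mulnC muln_gt0 => /andP[p_gt0 k_gt0].
have s_dvd_k : all (fun q => q %| k)%N s.
  apply/allP=> q qs; have := allP s_dvd_N q qs.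
  by rewrite def_N Gauss_dvdl // coprime_sym co_p_s.
pose avoids m := all (fun q => ~~ (q %| m)%N) s.
have avoids_mul j : avoids (p * j)%N = avoids j.
  by apply: eq_in_all => q qs; rewrite Gauss_dvdr // coprime_sym co_p_s.
have legendre : \sum_(1 <= m < (p * k).+1 | avoids m) 1 =
    \sum_(1 <= j < k.+1 | avoids j) 1
      + \sum_(1 <= m < (p * k).+1 | ~~ (p %| m)%N && avoids m) 1 :> rat.
  under [X in _ = X + _]eq_bigl => j do rewrite -avoids_mul.
  rewrite -(sum_multiples _ p k avoids (fun=> 1)) // (bigID (dvdn p)) /=.
  by congr (_ + _); apply: eq_bigl => m; rewrite andbC.
move: legendre; rewrite !IHs ?muln_gt0 ?p_gt0 //; last first.
  by rewrite mulnC -def_N.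
move/esym/(canRL (addKr _)) => ->.
have p_neq0 : p%:R != 0 :> rat by rewrite Num.Theory.pnatr_eq0 -lt0n.
rewrite big_cons mulrA mulrBr mulr1 mulrBl natrM (mulrC p%:R) mulfK //.
by rewrite addrC.
Qed.

End Sieve.

Theorem theorem2p1 (l n : nat) (hl : 1 <= l) (hn : 0 < n) :
  euler_totient l n = (#|B l n|%:R)%R.
Proof.
pose s := [seq p <- index_iota 1 n.+1 | prime p && (p ^ l %| n)].
have mem_s p : (p \in s) = prime p && (p ^ l %| n).
  rewrite mem_filter mem_index_iota ltnS; apply: andb_idr => /andP[p_pr p_dvd].
  by rewrite prime_gt0 // (prime_pow_dvd_le hl).
rewrite /euler_totient -big_filter -/s -count_sieve //; last first.
- apply/allP=> p; rewrite mem_s => /andP[_]; apply: dvdn_trans.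
  exact: dvdn_exp.
- have: uniq s by rewrite filter_uniq ?iota_uniq.
  rewrite uniq_pairwise; apply: (@sub_in_pairwise _ (mem s)) => [p q|]; last exact: allss.
  rewrite !mem_s => /andP[p_pr _] /andP[q_pr _].
  by rewrite prime_coprime // dvdn_prime2.
rewrite -sum1_card natr_sum big_geq_mkord; apply: eq_bigl => m.
apply/andP/idP => [[/allP avoid_s m_gt0]|/(in_B _ hl hn)[/andP[m_gt0 _] mB]].
  apply/(in_B _ hl hn); rewrite m_gt0 -ltnS ltn_ord; split=> // p p_pr p_dvd.
  by apply: avoid_s; rewrite mem_s p_pr.
by split=> //; apply/allP=> p; rewrite mem_s => /andP[]; exact: mB.
Qed.
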